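(* (1) Let $G$ be a free abelian group (of arbitrary rank). Then every non-empty finite subset $A$ of $G$ is part of some co-minimal pair in $G$, i.e., there exists a subset $B\subseteq G$ such that $(A,B)$ is a co-minimal pair. (2) Let $G$ be any group and let $S\subseteq G$ be a subset with exactly two elements. Then there exist subsets $L,R\subseteq G$ such that $(S,R)$ and $(L,S)$ are co-minimal pairs in $G$.
   Context: Let $(G,\cdot)$ be a group and $A,B$ non-empty subsets. $A$ is a left complement of $B$ (and $B$ a right complement of $A$) if $A\cdot B=G$. $A$ is a minimal left complement of $B$ if $A\cdot B=G$ and $(A\setminus\{a\})\cdot B\neq G$ for all $a\in A$; $B$ is a minimal right complement of $A$ if $A\cdot B=G$ and $A\cdot(B\setminus\{b\})\neq G$ for all $b\in B$. The pair $(A,B)$ is a co-minimal pair if $A$ is a minimal left complement of $B$ and $B$ is a minimal right complement of $A$. In an abelian group (written additively) left and right notions coincide. *)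

(* Defs.v *)
From mathcomp Require Import all_boot all_order all_algebra.
From mathcomp Require Import boolp classical_sets cardinality.
From mathcomp Require Import freeg.

Set Implicit Arguments.
Unset Strict Implicit.
Unset Printing Implicit Defensive.

Local Open Scope classical_set_scope.
Local Open Scope group_scope.

Section Complements.
Variable G : groupType.
Implicit Types A B : set G.

(* If is_complement A B holds, then A and B are non-empty, because 1 lies in
   A * B. *)
Definition is_complement A B : Prop :=
  [set a * b | a in A & b in B] = [set: G].

Definition minimal_left_complement A B : Prop :=
  is_complement A B /\ forall a, A a -> ~ is_complement (A `\ a) B.

(* B is a minimal right complement of A: the argument order is that of the
   product A * B *)
Definition minimal_right_complement A B : Prop :=
  is_complement A B /\ forall b, B b -> ~ is_complement A (B `\ b).

Definition co_minimal_pair A B : Prop :=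
  minimal_left_complement A B /\ minimal_right_complement A B.

End Complements.

(* {freeg K} is the group of formal sums of elements of K with coefficients in
   int.  The type K of generators may have any cardinality. *)
Definition free_abelian (G : zmodType) : Prop :=
  exists (K : choiceType) (f : {additive {freeg K} -> G}), bijective f.

(* Main.v *)
Require Import Defs.
From mathcomp Require Import all_boot all_order all_algebra.
From mathcomp Require Import boolp classical_sets cardinality.
From mathcomp Require Import freeg.

Import GRing.Theory Num.Theory.

Set Implicit Arguments.
Unset Strict Implicit.
Unset Printing Implicit Defensive.

Local Open Scope classical_set_scope.
Local Open Scope card_scope.

(** By Zorn's lemma, every right complement [C] of a finite set [A] contains a
    minimal one [B].  It remains to choose [C] so that, for each [a] in [A],
    some [g a] is written in [A * C] only as a product with left factor [a], so
    that [a] cannot be dropped from [A].  To this end remove from the group the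
    elements [a'^-1 * g a] with [a' != a] in [A]; if the points [g a] are far
    apart, what is left is still a complement of [A].  Far apart points exist in
    every infinite group, and a nontrivial free abelian group is infinite.  When
    [A = {x, y}], any minimal right complement [B] works: it is proper, and for
    [h] outside [B] the element [y * h] needs the left factor [x], and [x * h]
    the left factor [y]. *)

(** Finitely many members of a chain lie in the largest of them. The case [X = set0] is there
    because [K] may be empty. *)
Lemma chain_finite_cover (T : eqType) (K : set (set T)) (s : seq T) :
    total_on K subset ->
  exists X, (K X \/ X = set0) /\
    forall t, t \in s -> (\bigcup_(Y in K) Y) t -> X t.
Proof.
move=> totK; elim: s => [|t s [X [KX sX]]]; first by exists set0; split; [right|].
have [[Y KY Yt]|Kt] := pselect ((\bigcup_(Y in K) Y) t); last first.
  by exists X; split=> // u; rewrite inE => /orP[/eqP->|/sX].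
have [XY|YX] : X `<=` Y \/ Y `<=` X.
- by case: KX => [/totK/(_ KY)|->]; [|left].
- exists Y; split; first by left.
  by move=> u; rewrite inE => /orP[/eqP->//|/sX Xu /Xu/XY].
- exists X; split=> // u; rewrite inE => /orP[/eqP-> _|/sX//].
  exact: YX.
Qed.

Section GroupComplements.
Variable G : groupType.
Implicit Types (A B C F S : set G) (s : seq G).
Local Open Scope group_scope.

Lemma is_complementP A B :
  is_complement A B <-> forall g, exists2 a, A a & B (a^-1 * g).
Proof.
split=> [AB g | AB].
  have [a Aa [b Bb <-]] : [set a * b | a in A & b in B] g by rewrite AB.
  by exists a; rewrite ?mulKg.
apply/seteqP; split=> // g _; have [a Aa Bag] := AB g.
by exists a => //; exists (a^-1 * g); rewrite ?mulVKg.
Qed.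

(** Zorn's lemma is applied to the removed sets [E]. Whether [g] stays covered depends only on the
    finitely many [a^-1 * g], so a chain of admissible sets has an admissible union. *)
Lemma minimal_right_complement_exists A C :
    finite_set A -> is_complement A C ->
  exists2 B, B `<=` C & minimal_right_complement A B.
Proof.
move=> /finite_seqP[s As] AC.
have [|E [AE Emax]] := @Zorn_bigcup _ [set E | is_complement A (C `\` E)].
  move=> K KP totK; apply/is_complementP => g.
  have [X [KX sX]] := chain_finite_cover [seq a^-1 * g | a <- s] totK.
  have /is_complementP/(_ g)[a Aa [Cag Xag]] : is_complement A (C `\` X).
    by case: KX => [/KP//|->]; rewrite setD0.
  exists a => //; split=> // /sX; move/(_ _)/Xag; apply.
  by apply: map_f; rewrite As in Aa.
exists (C `\` E); first by move=> b [].
split=> // b [Cb Eb]; rewrite setDDl => AEb.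
apply: (Emax (E `|` [set b])) AEb; split; first by left.
by move=> /(_ b (or_intror erefl)).
Qed.

Lemma two_element_co_minimal S R (x y : G) :
    x <> y -> S = [set x; y] -> minimal_right_complement S R ->
  co_minimal_pair S R.
Proof.
move=> xy -> [SR minR]; split=> //; split=> // a Sa /is_complementP SaR.
have [h Rh] : exists h, ~ R h.
  apply: contrapT => /forallNP RT.
  have {}RT h : R h by apply: contrapT; apply: RT.
  (* The elements [x^-1 * g] and [y^-1 * g] are distinct, so one of them differs from [1]: were [R]
     the whole group, [1] could be dropped from it. *)
  apply: (minR 1) => //; apply/is_complementP => g.
  have [xg|xg] := pselect (x^-1 * g = 1); last by exists x; [left|].
  exists y; first by right.
  split=> //= yg; apply: xy.
  by rewrite -[x]mulg1 -xg -[y]mulg1 -yg !mulVKg.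
have [a' Saa'] : exists a', forall c, ([set x; y] `\ a) c -> c = a'.
  by case: Sa => ->; [exists y|exists x] => c [[]].
have [c /Saa'->] := SaR (a' * h).
by rewrite mulKg.
Qed.

Definition setV A : set G := [set g | A g^-1].

Let is_complementV A B :
  is_complement A B -> is_complement (setV B) (setV A).
Proof.
move=> /is_complementP AB; apply/is_complementP => g.
have [a Aa Bag] := AB g^-1.
exists (a^-1 * g^-1)^-1; rewrite /setV /= ?invgK //.
by rewrite mulgVK invgK.
Qed.

(** Inversion reverses products, so it exchanges the two sides; this turns right partners into left
    ones. *)
Lemma co_minimal_pairV A B :
  co_minimal_pair A B -> co_minimal_pair (setV B) (setV A).
Proof.
have preK X : setV (setV X) = X.
  by apply/seteqP; split=> g; rewrite /setV /= invgK.
have preD X (a : G) : setV (setV X `\ a) = X `\ a^-1.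
  apply/seteqP; split=> g; rewrite /setV /= invgK => -[Xg ga]; split=> // ga'.
    by apply: ga; rewrite ga' invgK.
  by apply: ga; rewrite -ga' invgK.
move=> [[AB minA] [_ minB]]; have BA := is_complementV AB.
split; split=> // a Xa /is_complementV.
- by rewrite preD preK; apply: minB.
- by rewrite preD preK; apply: minA.
Qed.

(** The points are chosen one at a time: each new value [v] avoids a finite set [V], whose two parts
    treat the quotients with [v] on the left and with [v^-1] on the right. *)
Lemma spread_points F s :
    infinite_set [set: G] -> finite_set F ->
  exists g : G -> G, forall a b, a \in s -> b \in s -> a <> b ->
    ~ F (g a * (g b)^-1).
Proof.
move=> Ginf Ffin; elim: s => [|c s [g gP]]; first by exists id.
pose V := [set f * g b | f in F & b in [set` s]] `|`
          [set f^-1 * g b | f in F & b in [set` s]].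
have [v Vv] : exists v, ~ V v.
  apply: contrapT => /forallNP VT; apply: Ginf.
  apply: (@sub_finite_set _ _ V) => [v _|]; first exact: contrapT (VT v).
  by rewrite finite_setU; split; apply: finite_image2.
exists (fun t => if t == c then v else g t) => a b; rewrite !inE.
have [->|ac] := eqVneq a c; have [->|bc] := eqVneq b c => //=; last exact: gP.
- move=> _ sb _ Fvb; apply: Vv; left.
  by exists (v * (g b)^-1) => //; exists b; rewrite ?mulgVK.
- move=> sa _ _ Fav; apply: Vv; right.
  by exists (g a * v^-1) => //; exists a; rewrite ?invgM ?invgK ?mulgVK.
Qed.

(** The hypothesis keeps the removed elements [q^-1 * g p] for different [p] apart: if
    [a^-1 * h = q^-1 * g p] and [b^-1 * h = r^-1 * g p'], then
    [g p * (g p')^-1 = q * a^-1 * (b * r^-1)]. *)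
Lemma co_minimal_of_spread A (g : G -> G) :
    A !=set0 -> finite_set A ->
    (forall p q a b c d, A p -> A q -> p <> q -> A a -> A b -> A c -> A d ->
       g p * (g q)^-1 <> a * b^-1 * (c * d^-1)) ->
  exists B, co_minimal_pair A B.
Proof.
move=> [a0 Aa0] Afin gP; have /finite_seqP[s0 As0] := Afin.
have [s sU As] : exists2 s, uniq s & A = [set` s].
  exists (undup s0); first exact: undup_uniq.
  by rewrite As0; apply/seteqP; split=> t /=; rewrite mem_undup.
pose D : set G := [set u | exists p q, [/\ A p, A q, p <> q & u = q^-1 * g p]].
have AC : is_complement A (~` D).
  apply/is_complementP => h; apply: contrapT => hD.
  have {}hD a : A a -> D (a^-1 * h).
    by move=> Aa; apply: contrapT => ?; apply: hD; exists a.
  have [p [q0 [Ap Aq0 pq0 e0]]] := hD _ Aa0.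
  have {}e0 : h = a0 * q0^-1 * g p by rewrite -mulgA -e0 mulVKg.
  pose u := g p * h^-1.
  (* All the elements [a^-1 * h] lie in the piece of [D] attached to [p], so
     [u] maps the finite set [A] into [A] minus [p]. *)
  have uA a : A a -> A (u * a) /\ u * a <> p.
    move=> Aa; have [p' [q [Ap' Aq p'q e]]] := hD _ Aa.
    have {}e : h = a * q^-1 * g p' by rewrite -mulgA -e mulVKg.
    have [pp'|pp'] := pselect (p = p'); last first.
      case: (gP p p' q0 a0 a q) => //.
      have -> : g p = q0 * a0^-1 * h by rewrite e0 !mulgA mulgVK mulgV mul1g.
      by rewrite e !mulgA mulgK.
    have -> : u * a = q.
      by rewrite /u e -pp' !invgM !invgK !mulgA mulgV mul1g mulgVK.
    by split=> // qp; apply: p'q; rewrite -pp' qp.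
  have uI : uniq [seq u * a | a <- s] by rewrite map_inj_uniq //; apply: mulgI.
  have us : {subset [seq u * a | a <- s] <= s}.
    move=> _ /mapP[a sa ->]; have [] := uA a; first by rewrite As.
    by rewrite As.
  (* Translation by [u] is injective, so it would permute the finite set [A] and reach [p]. *)
  have [|_ sE] := uniq_min_size uI us; first by rewrite size_map.
  have : p \in s by move: Ap; rewrite As.
  by rewrite -sE => /mapP[a sa pE]; have [] := uA a; rewrite ?As // -pE.
have [B BC [AB minB]] := minimal_right_complement_exists Afin AC.
exists B; split; split=> // a Aa /is_complementP /(_ (g a)).
move=> [q [Aq qa] Bq]; apply: (BC _ Bq).
by exists a, q; split=> // /esym.
Qed.

Lemma infinite_co_minimal A :
    infinite_set [set: G] -> A !=set0 -> finite_set A ->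
  exists B, co_minimal_pair A B.
Proof.
move=> Ginf A0 Afin; have /finite_seqP[s As] := Afin.
pose Q : set G := [set a * b^-1 | a in A & b in A].
have Qfin : finite_set Q by apply: finite_image2.
have [g gP] := spread_points s Ginf (finite_image2 *%g Qfin Qfin).
apply: (co_minimal_of_spread (g := g)) => // p q a b c d Ap Aq pq Aa Ab Ac Ad E.
rewrite As in Ap Aq; apply: (gP p q) => //.
by exists (a * b^-1); [exists a => //; exists b|exists (c * d^-1)];
  rewrite ?E //; exists c => //; exists d.
Qed.

End GroupComplements.

(** Some integer coefficient of [f' x] is nonzero, so the multiples of [x] are pairwise distinct. *)
Lemma free_abelian_infinite (G : zmodType) (x : G) :
  free_abelian G -> x <> 0%R -> infinite_set [set: G].
Proof.
move=> [K [f [f' fK f'K]]] x0 Gfin; apply: infinite_nat.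
pose D := f' x; have D0 : D <> 0%R.
  by move=> D0; apply: x0; rewrite -(f'K x) -/D D0 raddf0.
have [k Dk] : exists k, coeff k D <> 0%R.
  apply: contrapT => /forallNP Dk; apply: D0; apply/eqP/freeg_eqP => k.
  by rewrite /= coeff0; apply: contrapT; apply: Dk.
apply: (@sub_finite_set _ _ ((fun n => x *+ n)%R @^-1` [set: G])) => //.
apply: finite_preimage => // m n _ _ /(congr1 (coeff k \o f')) /=.
have f'M j : f' (x *+ j)%R = (D *+ j)%R by rewrite -(fK (D *+ j)%R) raddfMn f'K.
rewrite (f'M m) (f'M n) (coeffMn k m D) (coeffMn k n D).
by apply: mulrIn; apply/eqP.
Qed.

Theorem theoremB :
  (forall G : zmodType, free_abelian G ->
     forall A : set G, A !=set0 -> finite_set A ->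
       exists B : set G, co_minimal_pair (G := Algebra.to_multiplicative G) A B) /\
  (forall (G : groupType) (S : set G), S #= `I_2 ->
     exists L R : set G, co_minimal_pair S R /\ co_minimal_pair L S).
Proof.
split=> [G Gfree A A0 Afin | G S /card_set_bijP[f [fI finj fsurj]]].
  have [[x x0]|G0] := pselect (exists x : G, x <> 0%R).
    have Ginf := free_abelian_infinite Gfree x0.
    exact: (@infinite_co_minimal (Algebra.to_multiplicative G)).
  (* In the trivial group [p <> q] never holds, so any choice of [g] will do. *)
  apply: (@co_minimal_of_spread (Algebra.to_multiplicative G) A id) => // p q *.
  by case: G0; have [p0|] := pselect (p = 0%R :> G); [exists q|exists p]; congruence.
have [x Sx fx] := fsurj 0%N isT; have [y Sy fy] := fsurj 1%N isT.
have xy : x <> y by move=> xy; move: fx; rewrite xy fy.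
have SE : S = [set x; y].
  apply/seteqP; split=> [z Sz|z [->|->]//].
  have := fI z; rewrite /=; case fz: (f z) => [|[|n]] => [_|_|/(_ Sz)//].
    by left; apply: finj; rewrite ?inE ?fz.
  by right; apply: finj; rewrite ?inE ?fz.
have co_min2 (u v : G) : u <> v -> exists R, co_minimal_pair [set u; v] R.
  move=> uv.
  have cT : is_complement [set u; v] [set: G].
    by apply/is_complementP => g; exists u; [left|].
  have [R _ minR] := minimal_right_complement_exists (finite_set2 u v) cT.
  by exists R; apply: (two_element_co_minimal uv).
have [R SR] := co_min2 x y xy.
(* A right partner of the set of inverses becomes, after inversion, a left partner of [S]. *)
have [|R' SR'] := co_min2 x^-1%g y^-1%g; first by move/invg_inj.
exists (setV R'), R; rewrite SE; split=> //.
suff -> : [set x; y] = setV [set x^-1; y^-1]%g by apply: co_minimal_pairV.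
by apply/seteqP; split=> z /= [/eqP|/eqP]; [left|right|left|right]; apply/eqP;
  rewrite ?(inj_eq invg_inj) // -(inj_eq invg_inj).
Qed.
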